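(* Let $\mathcal L$ be a left bialgebroid over $B$, and let $\mathcal B(\mathcal L)$ be the set of left bisections of $\mathcal L$. Then $\mathcal B(\mathcal L)$ is a monoid with the product $(\sigma\ast\eta)(X)=\sigma(s(\eta(X_{(1)}))X_{(2)})$ and with identity the counit $\varepsilon$ of $\mathcal L$. If $\mathcal L$ is a left Hopf algebroid, then $\mathcal B(\mathcal L)$ is a group, with the inverse of a left bisection $\sigma$ given by $$\sigma^{-1}(X)=(\sigma\circ s)^{-1}\big(\varepsilon(X_{+}\,t(\sigma(X_{-})))\big)$$ for all $X\in\mathcal L$. The vertical left bisections $\mathcal B_{ver}(\mathcal L)$ form a submonoid (respectively a subgroup, when $\mathcal L$ is a left Hopf algebroid), on which the product reduces to the opposite convolution product, $(\sigma\ast\tau)(X)=\tau(X_{(1)})\sigma(X_{(2)})$.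
   Context: All algebras are unital associative over a field $k$ and algebra maps are unital. Let $B$ be an algebra. A left $B$-bialgebroid is an algebra $\mathcal L$ with algebra maps $s:B\to\mathcal L$ (source) and $t:B^{op}\to\mathcal L$ (target) such that $s(b)t(b')=t(b')s(b)$, made a $B$-bimodule by $b.X.c=s(b)t(c)X$, together with $B$-bimodule maps $\Delta:\mathcal L\to\mathcal L\otimes_B\mathcal L$, $\Delta(X)=X_{(1)}\otimes_B X_{(2)}$, and $\varepsilon:\mathcal L\to B$ forming a $B$-coring (coassociative and counital), such that (i) $\Delta$ takes values in, and is an algebra map to, the Takeuchi product $\mathcal L\times_B\mathcal L=\{\sum_i X_i\otimes_B Y_i:\ \sum_i X_it(b)\otimes_B Y_i=\sum_i X_i\otimes_B Y_is(b)\ \forall b\in B\}$ (an algebra under factorwise multiplication); (ii) $\varepsilon(1)=1$ and $\varepsilon(Xs(\varepsilon(Y)))=\varepsilon(XY)=\varepsilon(Xt(\varepsilon(Y)))$. Here $\mathcal L\otimes_B\mathcal L$ is the quotient of $\mathcal L\otimes\mathcal L$ by the relations $t(b)X\otimes Y=X\otimes s(b)Y$. $\mathcal L$ is a left Hopf algebroid if the map $\lambda:\mathcal L\otimes_{B^{op}}\mathcal L\to\mathcal L\otimes_B\mathcal L$, $\lambda(X\otimes Y)=X_{(1)}\otimes_B X_{(2)}Y$ is bijective, where $\mathcal L\otimes_{B^{op}}\mathcal L$ is the quotient by $Xt(b)\otimes Y=X\otimes t(b)Y$. One writes $X_+\otimes_{B^{op}}X_-:=\lambda^{-1}(X\otimes_B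 1)$. A left bisection on a left bialgebroid $\mathcal L$ over $B$ is a unital linear map $\sigma:\mathcal L\to B$ such that (1) $\sigma(t(b)X)=\sigma(X)b$; (2) $\phi:=\sigma\circ s\in\mathrm{Aut}(B)$ (algebra automorphisms); (3) $\sigma(XY)=\sigma(Xt(\sigma(Y)))=\sigma(Xs(\phi^{-1}(\sigma(Y))))$, for all $b\in B$, $X,Y\in\mathcal L$. It is vertical if $\sigma\circ s=\mathrm{id}_B$. *)

(* Defs.v *)
From HB Require Import structures.
From mathcomp Require Import all_boot all_algebra.
From mathcomp Require Import boolp classical_sets functions.

Set Implicit Arguments.
Unset Strict Implicit.
Unset Printing Implicit Defensive.

Import GRing.Theory.
Local Open Scope classical_set_scope.
Local Open Scope ring_scope.
Local Open Scope quotient_scope.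

(* Makes [{lrmorphism B^c -> L}], algebra maps from B^op, available. *)
HB.instance Definition _ (k : pzRingType) (A : lmodType k) :=
  GRing.Lmodule.copy A^c A.
HB.instance Definition _ (k : pzRingType) (A : algType k) :=
  GRing.Lmodule_isLalgebra.Build k A^c
    (fun a (u v : A) => scalerAr a v u).

(* Balanced tensor products: the quotient of the tensor product of M and N over
   k by the subspace spanned by the elements  (r i x) (x) y - x (x) (l i y).
   It is presented by generators and relations: a list of pairs stands for the
   sum of the corresponding pure tensors.  The coefficient a in [tens_bal]
   makes the relations stable under scaling even if r i is not linear. *)

Section BalancedTensor.
Context {k : fieldType} {I : Type} {M N : lmodType k}.
Variables (r : I -> M -> M) (l : I -> N -> N).

Inductive tens_rel : seq (M * N) -> seq (M * N) -> Prop :=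
| tens_refl s : tens_rel s s
| tens_sym s1 s2 : tens_rel s1 s2 -> tens_rel s2 s1
| tens_trans s1 s2 s3 : tens_rel s1 s2 -> tens_rel s2 s3 -> tens_rel s1 s3
| tens_cat s1 s1' s2 s2' :
    tens_rel s1 s1' -> tens_rel s2 s2' -> tens_rel (s1 ++ s2) (s1' ++ s2')
| tens_catC s1 s2 : tens_rel (s1 ++ s2) (s2 ++ s1)
| tens_zero y : tens_rel [:: (0, y)] [::]
| tens_addl x x' y : tens_rel [:: (x + x', y)] [:: (x, y); (x', y)]
| tens_addr x y y' : tens_rel [:: (x, y + y')] [:: (x, y); (x, y')]
| tens_scale (a : k) x y : tens_rel [:: (a *: x, y)] [:: (x, a *: y)]
| tens_bal (a : k) i x y : tens_rel [:: (a *: r i x, y)] [:: (a *: x, l i y)].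

Definition tens_relb (s1 s2 : seq (M * N)) : bool := `[< tens_rel s1 s2 >].

Lemma tens_relb_refl : reflexive tens_relb.
Proof. by move=> s; apply/asboolP; apply: tens_refl. Qed.

Lemma tens_relb_sym : symmetric tens_relb.
Proof. by move=> s s'; apply/asboolP/asboolP; apply: tens_sym. Qed.

Lemma tens_relb_trans : transitive tens_relb.
Proof.
by move=> s s' s'' /asboolP h1 /asboolP h2; apply/asboolP; apply: tens_trans h2.
Qed.

Canonical tens_relb_equiv :=
  EquivRel tens_relb tens_relb_refl tens_relb_sym tens_relb_trans.

Definition btens := {eq_quot tens_relb}.
HB.instance Definition _ := Choice.on btens.
HB.instance Definition _ := EqQuotient.on btens.

Definition tens_of (s : seq (M * N)) : btens := \pi_btens s.

Lemma tens_ofP s s' : tens_of s = tens_of s' <-> tens_rel s s'.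
Proof.
split=> [/eqmodP h|h]; first exact/asboolP.
by apply/eqmodP/asboolP.
Qed.

Lemma repr_tensK (u : btens) : tens_of (repr u) = u.
Proof. exact: reprK. Qed.

Lemma tens_repr s : tens_rel (repr (tens_of s)) s.
Proof. by apply/tens_ofP; rewrite repr_tensK. Qed.

Let scl (a : k) (s : seq (M * N)) := [seq (a *: p.1, p.2) | p <- s].

Let tens_rel_scl a s s' : tens_rel s s' -> tens_rel (scl a s) (scl a s').
Proof.
elim=> {s s'}.
- by move=> s; apply: tens_refl.
- by move=> s s' _; apply: tens_sym.
- by move=> s1 s2 s3 _ h _; apply: tens_trans.
- by move=> s1 s1' s2 s2' _ h1 _ h2; rewrite /scl !map_cat; apply: tens_cat.
- by move=> s1 s2; rewrite /scl !map_cat; apply: tens_catC.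
- by move=> y /=; rewrite scaler0; apply: tens_zero.
- by move=> x x' y /=; rewrite scalerDr; apply: tens_addl.
- by move=> x y y'; apply: tens_addr.
- by move=> b x y /=; rewrite scalerA mulrC -scalerA; apply: tens_scale.
- by move=> b i x y /=; rewrite !scalerA; apply: tens_bal.
Qed.

Let scl_cons_rel a b s :
  tens_rel (scl (a + b) s) (scl a s ++ scl b s).
Proof.
elim: s => [|[x y] s ih] /=; first exact: tens_refl.
apply: (@tens_trans _ ([:: (a *: x, y); (b *: x, y)] ++ (scl a s ++ scl b s))).
  by rewrite scalerDl; apply: (@tens_cat [:: _]) ih; apply: tens_addl.
rewrite /= -(cat1s (a *: x, y)) -(cat1s (a *: x, y) (_ ++ _)).
apply: tens_cat; first exact: tens_refl.
rewrite -(cat1s (b *: x, y)) -(cat1s (b *: x, y) (scl b s)) !catA.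
by apply: tens_cat; [exact: tens_catC|exact: tens_refl].
Qed.

Let scl0_rel s : tens_rel (scl 0 s) [::].
Proof.
elim: s => [|[x y] s ih] /=; first exact: tens_refl.
by rewrite scale0r; apply: (@tens_cat [:: _] [::]) ih; apply: tens_zero.
Qed.

Let scl1 s : scl 1 s = s.
Proof. by rewrite -[RHS]map_id; apply: eq_map => -[x y] /=; rewrite scale1r. Qed.

Let tzero : btens := tens_of [::].
Let tadd (u v : btens) : btens := tens_of (repr u ++ repr v).
Let tscale (a : k) (u : btens) : btens := tens_of (scl a (repr u)).
Let topp (u : btens) : btens := tscale (-1) u.

Let taddE s s' : tadd (tens_of s) (tens_of s') = tens_of (s ++ s').
Proof. by apply/tens_ofP; apply: tens_cat; apply: tens_repr. Qed.

Let tscaleE a s : tscale a (tens_of s) = tens_of (scl a s).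
Proof. by apply/tens_ofP; apply: tens_rel_scl; apply: tens_repr. Qed.

Let tP (P : btens -> Prop) : (forall s, P (tens_of s)) -> forall u, P u.
Proof. by move=> h u; rewrite -[u]repr_tensK. Qed.

Let taddA : associative tadd.
Proof.
elim/tP=> s1; elim/tP=> s2; elim/tP=> s3.
by rewrite !taddE catA.
Qed.

Let taddC : commutative tadd.
Proof.
by elim/tP=> s1; elim/tP=> s2; rewrite !taddE; apply/tens_ofP; apply: tens_catC.
Qed.

Let tadd0 : left_id tzero tadd.
Proof. by elim/tP=> s; rewrite taddE. Qed.

Let taddN : left_inverse tzero topp tadd.
Proof.
elim/tP=> s; rewrite /topp tscaleE taddE; apply/tens_ofP.
rewrite -{2}[s]scl1; apply: tens_trans (tens_sym (scl_cons_rel _ _ _)) _.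
by rewrite addNr; apply: scl0_rel.
Qed.

HB.instance Definition _ := GRing.isZmodule.Build btens taddA taddC tadd0 taddN.

Let tscaleA a b u : tscale a (tscale b u) = tscale (a * b) u.
Proof.
elim/tP: u => s; rewrite !tscaleE /scl -map_comp; congr tens_of.
by apply: eq_map => -[x y] /=; rewrite scalerA.
Qed.

Let tscale1 : left_id 1 tscale.
Proof. by elim/tP=> s; rewrite tscaleE scl1. Qed.

Let tscaleDr : right_distributive tscale +%R.
Proof.
move=> a; elim/tP=> s1; elim/tP=> s2; rewrite -[_ + _]/(tadd _ _).
rewrite -[RHS]/(tadd _ _) taddE !tscaleE taddE.
by rewrite /scl map_cat.
Qed.

Let tscaleDl u : {morph tscale^~ u : a b / a + b}.
Proof.
elim/tP: u => s a b; rewrite -[RHS]/(tadd _ _) !tscaleE taddE.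
by apply/tens_ofP; apply: scl_cons_rel.
Qed.

HB.instance Definition _ :=
  GRing.Zmodule_isLmodule.Build k btens tscaleA tscale1 tscaleDr tscaleDl.

Definition tpure (x : M) (y : N) : btens := tens_of [:: (x, y)].

Lemma tens_of_nil : tens_of [::] = 0. Proof. by []. Qed.

Lemma tens_of_cat s s' : tens_of (s ++ s') = tens_of s + tens_of s'.
Proof. by rewrite -[RHS]/(tadd _ _) taddE. Qed.

Lemma tens_ofE s : tens_of s = \sum_(p <- s) tpure p.1 p.2.
Proof.
elim: s => [|[x y] s ih]; first by rewrite big_nil.
by rewrite -cat1s tens_of_cat ih big_cons.
Qed.

Lemma tensE (u : btens) : u = \sum_(p <- repr u) tpure p.1 p.2.
Proof. by rewrite -tens_ofE repr_tensK. Qed.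

Lemma tpure_linearl a x x' y :
  tpure (a *: x + x') y = a *: tpure x y + tpure x' y.
Proof.
rewrite -[a *: tpure x y]/(tscale _ _) tscaleE /= -tens_of_cat /=.
by apply/tens_ofP; apply: tens_addl.
Qed.

Lemma tpure_linearr a x y y' :
  tpure x (a *: y + y') = a *: tpure x y + tpure x y'.
Proof.
rewrite -[a *: tpure x y]/(tscale _ _) tscaleE /= -tens_of_cat /=.
apply/tens_ofP; apply: tens_trans (tens_addr _ _ _) _.
apply: (@tens_cat [:: _] [:: _]); last exact: tens_refl.
exact/tens_sym/tens_scale.
Qed.

Lemma tpure_bal i x y : tpure (r i x) y = tpure x (l i y).
Proof.
apply/tens_ofP; rewrite -[r i x]scale1r.
by apply: tens_trans (tens_bal _ _ _ _) _; rewrite scale1r; apply: tens_refl.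
Qed.

(* The map induced on the quotient by a balanced bilinear map f.  It is written
   with a chosen representative so that it makes sense for every f; [tlift_sum]
   shows that the choice is irrelevant when f is bilinear and balanced. *)
Definition tlift (V : lmodType k) (f : M -> N -> V) (u : btens) : V :=
  \sum_(p <- repr u) f p.1 p.2.

Record balanced (V : lmodType k) (f : M -> N -> V) : Prop := Balanced {
  bal_linl : forall y, linear (f^~ y);
  bal_linr : forall x, linear (f x);
  bal_eq : forall i x y, f (r i x) y = f x (l i y)
}.

Lemma tpure_balanced : balanced tpure.
Proof.
split=> [y a u v|x a u v|i x y].
- exact: tpure_linearl.
- exact: tpure_linearr.
- exact: tpure_bal.
Qed.

Section Lift.
Variables (V : lmodType k) (f : M -> N -> V).
Hypothesis fP : balanced f.

Lemma tlift_sum s : tlift f (tens_of s) = \sum_(p <- s) f p.1 p.2.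
Proof.
have f0 y : f 0 y = 0.
  have := bal_linl fP y (-1) 0 0.
  by rewrite scaler0 addr0 scaleN1r addNr.
have fZl a x y : f (a *: x) y = a *: f x y.
  by have := bal_linl fP y a x 0; rewrite f0 !addr0.
have fZr a x y : f x (a *: y) = a *: f x y.
  have := bal_linr fP x a y 0.
  have := bal_linr fP x (-1) 0 0.
  by rewrite scaler0 addr0 scaleN1r addNr => ->; rewrite !addr0.
suff sumP s1 s2 : tens_rel s1 s2 ->
    \sum_(p <- s1) f p.1 p.2 = \sum_(p <- s2) f p.1 p.2.
  by rewrite /tlift; apply/sumP/tens_repr.
elim=> {s s1 s2} //.
- by move=> s1 s2 s3 _ -> _ ->.
- by move=> s1 s1' s2 s2' _ h1 _ h2; rewrite !big_cat h1 h2.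
- by move=> s1 s2; rewrite !big_cat /= addrC.
- by move=> y; rewrite big_seq1 big_nil f0.
- move=> x x' y; rewrite !big_cons !big_nil /= !addr0.
  by have := bal_linl fP y 1 x x'; rewrite !scale1r.
- move=> x y y'; rewrite !big_cons !big_nil /= !addr0.
  by have := bal_linr fP x 1 y y'; rewrite !scale1r.
- by move=> a x y; rewrite !big_seq1 /= fZl fZr.
- by move=> a i x y; rewrite !big_seq1 /= !fZl (bal_eq fP).
Qed.

Lemma tlift_pure x y : tlift f (tpure x y) = f x y.
Proof. by rewrite tlift_sum big_seq1. Qed.

Lemma tlift_linear : linear (tlift f).
Proof.
move=> a; elim/tP=> s1; elim/tP=> s2.
rewrite -[a *: tens_of s1]/(tscale _ _) tscaleE -tens_of_cat !tlift_sum.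
rewrite big_cat /= big_map scaler_sumr; congr (_ + _).
apply: eq_bigr => -[x y] _ /=.
have f0 : f 0 y = 0.
  have := bal_linl fP y (-1) 0 0.
  by rewrite scaler0 addr0 scaleN1r addNr.
by have := bal_linl fP y a x 0; rewrite f0 !addr0.
Qed.

End Lift.

Lemma tens_ext (V : lmodType k) (g h : btens -> V) : linear g -> linear h ->
  (forall x y, g (tpure x y) = h (tpure x y)) -> g =1 h.
Proof.
move=> lg lh gh u; rewrite (tensE u).
have lin0 (f : btens -> V) : linear f -> f 0 = 0.
  by move=> lf; have := lf (-1) 0 0; rewrite scaler0 addr0 scaleN1r addNr.
elim: (repr u) => [|p s ih]; first by rewrite !big_nil !lin0.
rewrite !big_cons -[tpure _ _]scale1r (lg 1) (lh 1) gh.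
by rewrite ih.
Qed.

End BalancedTensor.

Arguments tpure {k I M N} r l x y.
Arguments tens_of {k I M N} r l s.
Arguments tlift {k I M N r l V} f u.

Section TensorMap.
Context {k : fieldType} {I I' : Type} {M N M' N' : lmodType k}.
Context {r : I -> M -> M} {l : I -> N -> N}.
Context {r' : I' -> M' -> M'} {l' : I' -> N' -> N'}.

(* f (x) g, meaningful when (x, y) |-> f x (x) g y is balanced. *)
Definition tmap (f : M -> M') (g : N -> N') : btens r l -> btens r' l' :=
  tlift (fun x y => tpure r' l' (f x) (g y)).

Variables (f : M -> M') (g : N -> N').
Hypotheses (lf : linear f) (lg : linear g).
Hypothesis fgP : forall i x y,
  tpure r' l' (f (r i x)) (g y) = tpure r' l' (f x) (g (l i y)).

Lemma tmap_balanced : balanced r l (fun x y => tpure r' l' (f x) (g y)).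
Proof.
split=> [y a u v|x a u v|i x y]; last exact: fgP.
- by rewrite lf tpure_linearl.
- by rewrite lg tpure_linearr.
Qed.

Lemma tmap_pure x y : tmap f g (tpure r l x y) = tpure r' l' (f x) (g y).
Proof. exact: tlift_pure tmap_balanced _ _. Qed.

Lemma tmap_linear : linear (tmap f g).
Proof. exact: tlift_linear tmap_balanced. Qed.

End TensorMap.

Section LinearFacts.
Context {k : fieldType}.

Lemma id_linear (V : lmodType k) : linear (@id V). Proof. by []. Qed.

Lemma mull_linear (A : algType k) (a : A) : linear (fun x => a * x).
Proof. by move=> c u v; rewrite mulrDr scalerAr. Qed.

Lemma mulr_linear (A : algType k) (a : A) : linear (fun x => x * a).
Proof. by move=> c u v; rewrite mulrDl scalerAl. Qed.

Lemma comp_linear (U V W : lmodType k) (f : V -> W) (g : U -> V) :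
  linear f -> linear g -> linear (f \o g).
Proof. by move=> lf lg c u v /=; rewrite lg lf. Qed.

End LinearFacts.

Record be_ring (k : fieldType) (B : algType k) := BeRing {
  be_alg :> algType k;
  src : {lrmorphism B -> be_alg};
  tgt : {lrmorphism B^c -> be_alg};
  src_tgtC : forall b c : B, src b * tgt c = tgt c * src b
}.

Arguments src {k B b} : rename.
Arguments tgt {k B b} : rename.

Section BeRing.
Context {k : fieldType} {B : algType k} (L : be_ring B).

Lemma tgtM (b c : B) : tgt (b * c) = tgt c * tgt b :> L.
Proof. exact: (rmorphM (tgt : {lrmorphism B^c -> L}) c b). Qed.

Definition srcl (b : B) (x : L) : L := src b * x.
Definition tgtl (b : B) (x : L) : L := tgt b * x.
Definition srcr (b : B) (x : L) : L := x * src b.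
Definition tgtr (b : B) (x : L) : L := x * tgt b.

Lemma srcl_linear b : linear (srcl b). Proof. exact: mull_linear. Qed.
Lemma tgtl_linear b : linear (tgtl b). Proof. exact: mull_linear. Qed.
Lemma srcr_linear b : linear (srcr b). Proof. exact: mulr_linear. Qed.
Lemma tgtr_linear b : linear (tgtr b). Proof. exact: mulr_linear. Qed.

(* L (x)_B L: t(b)X (x) Y = X (x) s(b)Y. *)
Definition tensB := btens tgtl srcl.
(* L (x)_{B^op} L: X t(b) (x) Y = X (x) t(b)Y. *)
Definition tensBop := btens tgtr tgtl.

Definition pureB (x y : L) : tensB := tpure tgtl srcl x y.
Definition pureBop (x y : L) : tensBop := tpure tgtr tgtl x y.

Lemma pureB_bal b x y : pureB (tgt b * x) y = pureB x (src b * y).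
Proof. exact: tpure_bal. Qed.

Lemma pureBop_bal b x y : pureBop (x * tgt b) y = pureBop x (tgt b * y).
Proof. exact: tpure_bal. Qed.

(* The B-bimodule structure of L (x)_B L, inherited from the outer factors. *)
Definition tensB_lact (b : B) : tensB -> tensB := tmap (srcl b) id.
Definition tensB_ract (c : B) : tensB -> tensB := tmap id (tgtl c).

Lemma tensB_lact_bal b i x y :
  pureB (srcl b (tgtl i x)) y = pureB (srcl b x) (srcl i y).
Proof. by rewrite /srcl /tgtl mulrA src_tgtC -mulrA pureB_bal. Qed.

Lemma tensB_ract_bal c i x y :
  pureB (tgtl i x) (tgtl c y) = pureB x (tgtl c (srcl i y)).
Proof. by rewrite /srcl /tgtl pureB_bal !mulrA src_tgtC. Qed.

Lemma tensB_lact_linear b : linear (tensB_lact b).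
Proof. exact: tmap_linear (srcl_linear b) (@id_linear _ _) (@tensB_lact_bal b). Qed.

Lemma tensB_ract_linear c : linear (tensB_ract c).
Proof. exact: tmap_linear (@id_linear _ _) (tgtl_linear c) (@tensB_ract_bal c). Qed.

Lemma tensB_lact_pure b x y : tensB_lact b (pureB x y) = pureB (src b * x) y.
Proof. exact: tmap_pure (srcl_linear b) (@id_linear _ _) (@tensB_lact_bal b) _ _. Qed.

Lemma tensB_ract_pure c x y : tensB_ract c (pureB x y) = pureB x (tgt c * y).
Proof. exact: tmap_pure (@id_linear _ _) (tgtl_linear c) (@tensB_ract_bal c) _ _. Qed.

(* The two bracketings of L (x)_B L (x)_B L and the canonical map between them,
   (x (x) y) (x) z |-> x (x) (y (x) z). *)
Definition tensBl := btens tensB_ract srcl.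
Definition tensBr := btens tgtl tensB_lact.

Definition tens_assoc_at (z : L) : tensB -> tensBr :=
  tlift (fun x y => tpure tgtl tensB_lact x (pureB y z)).

Definition tens_assoc : tensBl -> tensBr := tlift (fun u z => tens_assoc_at z u).

Lemma tens_assoc_at_balanced z :
  balanced tgtl srcl (fun x y => tpure tgtl tensB_lact x (pureB y z)).
Proof.
split=> [y a u v|x a u v|i x y].
- exact: tpure_linearl.
- by rewrite /pureB tpure_linearl tpure_linearr.
- by rewrite tpure_bal tensB_lact_pure.
Qed.

Lemma tens_assoc_balanced :
  balanced tensB_ract srcl (fun u z => tens_assoc_at z u).
Proof.
have aux z : linear (tens_assoc_at z).
  exact: tlift_linear (tens_assoc_at_balanced z).
split=> [z|u a z z'|i u z]; first exact: aux.
  move: u; apply: tens_ext => [||x y].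
  - exact: aux.
  - move=> c u v; rewrite (aux z) (aux z') !scalerDr !scalerA mulrC.
    by rewrite -!addrA; congr (_ + _); rewrite addrCA.
  - rewrite /tens_assoc_at !(tlift_pure (tens_assoc_at_balanced _)).
    by rewrite /pureB !tpure_linearr.
move: u; apply: tens_ext => [||x y].
- by apply: comp_linear (aux z) (tensB_ract_linear i).
- exact: aux.
- rewrite tensB_ract_pure /tens_assoc_at.
  by rewrite !(tlift_pure (tens_assoc_at_balanced _)) pureB_bal.
Qed.

Lemma tens_assoc_pure x y z :
  tens_assoc (tpure tensB_ract srcl (pureB x y) z)
  = tpure tgtl tensB_lact x (pureB y z).
Proof.
rewrite /tens_assoc (tlift_pure tens_assoc_balanced).
exact: tlift_pure (tens_assoc_at_balanced z) _ _.
Qed.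

Definition takeuchi : set tensB :=
  [set u | forall b : B, tmap (tgtr b) id u = tmap id (srcr b) u :> tensB].

Lemma tgtr_id_bal b i x y :
  pureB (tgtr b (tgtl i x)) y = pureB (tgtr b x) (srcl i y).
Proof. by rewrite /tgtr /tgtl -mulrA pureB_bal. Qed.

Lemma id_srcr_bal b i x y :
  pureB (tgtl i x) (srcr b y) = pureB x (srcr b (srcl i y)).
Proof. by rewrite /srcr /tgtl pureB_bal mulrA. Qed.

Lemma takeuchi_sum s : takeuchi (tens_of tgtl srcl s) <->
  forall b : B, \sum_(p <- s) pureB (p.1 * tgt b) p.2
                = \sum_(p <- s) pureB p.1 (p.2 * src b).
Proof.
have h1 b := tlift_sum
  (tmap_balanced (tgtr_linear b) (@id_linear _ _) (@tgtr_id_bal b)) s.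
have h2 b := tlift_sum
  (tmap_balanced (@id_linear _ _) (srcr_linear b) (@id_srcr_bal b)) s.
split=> h b; have := h b.
  by rewrite /tmap h1 h2.
by rewrite /takeuchi /= /tmap h1 h2.
Qed.

(* Factorwise multiplication (x (x) y)(x' (x) y') = xx' (x) yy'.  It is well
   defined only if the first factor is in the Takeuchi product, see [tmul_sum]. *)
Definition tmul_at (x' y' : L) : tensB -> tensB :=
  tmap (fun x => x * x') (fun y => y * y').

Definition tmul (u v : tensB) : tensB := tlift (fun x' y' => tmul_at x' y' u) v.

Lemma tmul_at_bal x' y' i x y :
  pureB (tgtl i x * x') (y * y') = pureB (x * x') (srcl i y * y').
Proof. by rewrite /tgtl /srcl -!mulrA pureB_bal. Qed.

Lemma tmul_at_pure x' y' x y : tmul_at x' y' (pureB x y) = pureB (x * x') (y * y').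
Proof.
exact: tmap_pure (mulr_linear x') (mulr_linear y') (@tmul_at_bal x' y') _ _.
Qed.

Lemma tmul_at_linear x' y' : linear (tmul_at x' y').
Proof.
exact: tmap_linear (mulr_linear x') (mulr_linear y') (@tmul_at_bal x' y').
Qed.

Lemma tmul_balanced u : takeuchi u ->
  balanced tgtl srcl (fun x' y' => tmul_at x' y' u).
Proof.
move=> uT; split=> [y' a x1 x2|x' a y1 y2|i x' y'].
- move: u {uT}; apply: tens_ext => [||x y]; first exact: tmul_at_linear.
    move=> c u v; rewrite !tmul_at_linear !scalerDr !scalerA mulrC.
    by rewrite -!addrA; congr (_ + _); rewrite addrCA.
  by rewrite !tmul_at_pure mulrDr -scalerAr /pureB tpure_linearl.
- move: u {uT}; apply: tens_ext => [||x y]; first exact: tmul_at_linear.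
    move=> c u v; rewrite !tmul_at_linear !scalerDr !scalerA mulrC.
    by rewrite -!addrA; congr (_ + _); rewrite addrCA.
  by rewrite !tmul_at_pure mulrDr -scalerAr /pureB tpure_linearr.
have lT b := tmap_linear (tgtr_linear b) (@id_linear _ _) (@tgtr_id_bal b).
have lS b := tmap_linear (@id_linear _ _) (srcr_linear b) (@id_srcr_bal b).
have pT b := tmap_pure (tgtr_linear b) (@id_linear _ _) (@tgtr_id_bal b).
have pS b := tmap_pure (@id_linear _ _) (srcr_linear b) (@id_srcr_bal b).
transitivity (tmul_at x' y' (tmap (tgtr i) id u)).
  move: (u); apply: tens_ext => [||x y]; first exact: tmul_at_linear.
    exact: comp_linear (@tmul_at_linear x' y') (lT i).
  by rewrite /= pT !tmul_at_pure /tgtl /tgtr mulrA.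
rewrite uT; move: (u); apply: tens_ext => [||x y].
- exact: comp_linear (@tmul_at_linear x' y') (lS i).
- exact: tmul_at_linear.
by rewrite /= pS !tmul_at_pure /srcl /srcr mulrA.
Qed.

Lemma tmul_sum s s' : takeuchi (tens_of tgtl srcl s) ->
  tmul (tens_of tgtl srcl s) (tens_of tgtl srcl s')
  = \sum_(q <- s') \sum_(p <- s) pureB (p.1 * q.1) (p.2 * q.2).
Proof.
move=> sT; rewrite /tmul (tlift_sum (tmul_balanced sT)).
apply: eq_bigr => q _; rewrite /tmul_at /tmap.
exact: (tlift_sum
  (tmap_balanced (mulr_linear q.1) (mulr_linear q.2) (@tmul_at_bal q.1 q.2))).
Qed.

End BeRing.

Arguments tgtl {k B L}.
Arguments tgtr {k B L}.
Arguments srcl {k B L}.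
Arguments srcr {k B L}.
Arguments tensB_lact {k B L}.
Arguments tensB_ract {k B L}.

Record left_bialgebroid (k : fieldType) (B : algType k) := LeftBialgebroid {
  lb_ring :> be_ring B;
  comul : {linear lb_ring -> tensB lb_ring};
  counit : {linear lb_ring -> B};
  comul_bimod : forall (b c : B) (X : lb_ring),
    comul (src b * (tgt c * X)) = tensB_lact b (tensB_ract c (comul X));
  counit_bimod : forall (b c : B) (X : lb_ring),
    counit (src b * (tgt c * X)) = b * counit X * c;
  comulA : forall X : lb_ring,
    tens_assoc (tmap comul id (comul X)) = tmap id comul (comul X);
  counitl : forall X : lb_ring,
    tlift (fun X1 X2 => src (counit X1) * X2) (comul X) = X;
  counitr : forall X : lb_ring,
    tlift (fun X1 X2 => tgt (counit X2) * X1) (comul X) = X;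
  comul_takeuchi : forall X : lb_ring, takeuchi (comul X);
  comul1 : comul 1 = pureB 1 1;
  comulM : forall X Y : lb_ring, comul (X * Y) = tmul (comul X) (comul Y);
  counit1 : counit 1 = 1;
  counitM_src : forall X Y : lb_ring,
    counit (X * src (counit Y)) = counit (X * Y);
  counitM_tgt : forall X Y : lb_ring,
    counit (X * tgt (counit Y)) = counit (X * Y)
}.

Arguments comul {k B l} : rename.
Arguments counit {k B} l : rename.

Section Bisections.
Context {k : fieldType} {B : algType k} (L : left_bialgebroid B).

(* lambda(X (x) Y) = X_(1) (x) X_(2) Y *)
Definition hopf_map : tensBop L -> tensB L :=
  tlift (fun X Y => tmap id (fun Z => Z * Y) (comul X)).

Definition left_hopf : Prop := bijective hopf_map.

(* The inverse of a bijection; unspecified if f is not bijective. *)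
Definition bij_inv (U : lmodType k) (T : choiceType) (f : U -> T) : T -> U :=
  'pinv_(fun=> 0) setT f.

(* X_+ (x) X_- *)
Definition hopf_transl (X : L) : tensBop L := bij_inv hopf_map (pureB X 1).

Record algebra_automorphism (f : B -> B) : Prop := AlgebraAutomorphism {
  algaut_linear : linear f;
  algaut_monoid : monoid_morphism f;
  algaut_bij : bijective f
}.

Record left_bisection (sigma : L -> B) : Prop := LeftBisection {
  bisection_linear : linear sigma;
  bisection1 : sigma 1 = 1;
  bisection_tgt : forall (b : B) (X : L), sigma (tgt b * X) = sigma X * b;
  bisection_aut : algebra_automorphism (sigma \o src);
  bisectionM_tgt : forall X Y : L, sigma (X * Y) = sigma (X * tgt (sigma Y));
  bisectionM_src : forall X Y : L,
    sigma (X * Y) = sigma (X * src (bij_inv (sigma \o src) (sigma Y)))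
}.

Definition left_bisections : set (L -> B) := [set sigma | left_bisection sigma].

Definition vertical_bisections : set (L -> B) :=
  [set sigma | left_bisection sigma /\ sigma \o src = id].

Definition bisection_mul (sigma eta : L -> B) : L -> B :=
  fun X => tlift (fun X1 X2 => sigma (src (eta X1) * X2)) (comul X : tensB L).

Definition bisection_inv (sigma : L -> B) : L -> B :=
  fun X => bij_inv (sigma \o src)
    (tlift (fun Xp Xm => counit L (Xp * tgt (sigma Xm))) (hopf_transl X)).

End Bisections.

Arguments left_hopf {k B} L.
Arguments bisection_mul {k B} L.
Arguments bisection_inv {k B} L.
Arguments left_bisections {k B} L _.
Arguments vertical_bisections {k B} L _.

Section BisectionFacts.
Context {k : fieldType} {B : algType k} {L : left_bialgebroid B}.

Lemma bij_invK (U : lmodType k) (T : choiceType) (f : U -> T) :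
  bijective f -> cancel f (bij_inv f) /\ cancel (bij_inv f) f.
Proof.
move=> fB; have fI := bij_inj fB; split=> [x|y].
  by apply: pinvKV; rewrite ?inE// => ? ? _ _; apply: fI.
apply: pinvK; case: fB => g _ gK.
by rewrite inE; exists (g y).
Qed.

Lemma comul_tgt (b : B) (X : L) : comul (tgt b * X) = tensB_ract b (comul X).
Proof.
have /= := comul_bimod 1 b X; rewrite rmorph1 mul1r => ->.
move: (comul X); apply: tens_ext; [|exact: tensB_ract_linear|].
  exact: comp_linear (tensB_lact_linear 1) (tensB_ract_linear b).
by move=> x y; rewrite tensB_ract_pure tensB_lact_pure rmorph1 mul1r.
Qed.

Lemma comul_balanced :
  balanced tgtl srcl (fun X1 X2 : L => tpure tensB_ract srcl (comul X1) X2).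
Proof.
apply: (@tmap_balanced _ _ _ _ _ _ _ _ _ _ _ comul id) => [a u v|a u v|i x y].
- by rewrite linearP.
- by [].
- by rewrite comul_tgt tpure_bal.
Qed.

Lemma comul_src (b : B) (X : L) : comul (src b * X) = tensB_lact b (comul X).
Proof.
have := comul_bimod b 1 X; rewrite rmorph1 mul1r => ->; congr tensB_lact.
move: (comul X); apply: tens_ext; [exact: tensB_ract_linear|by []|].
by move=> x y; rewrite tensB_ract_pure rmorph1 mul1r.
Qed.

Lemma comul_balancedr :
  balanced tgtl srcl (fun X1 X2 : L => tpure tgtl tensB_lact X1 (comul X2)).
Proof.
apply: (@tmap_balanced _ _ _ _ _ _ _ _ _ _ _ id comul) => [a u v|a u v|i x y].
- by [].
- by rewrite linearP.
- by rewrite tpure_bal comul_src.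
Qed.

Lemma counit_src (b : B) (X : L) : counit L (src b * X) = b * counit L X.
Proof. by have := counit_bimod b 1 X; rewrite rmorph1 mul1r mulr1. Qed.

Lemma counit_tgt (b : B) (X : L) : counit L (tgt b * X) = counit L X * b.
Proof. by have := counit_bimod 1 b X; rewrite rmorph1 !mul1r. Qed.

Lemma counitl_balanced :
  balanced tgtl srcl (fun X1 X2 : L => src (counit L X1) * X2).
Proof.
split=> [y a u v|x a u v|i x y].
- by rewrite linearP linearP mulrDl scalerAl.
- by rewrite mulrDr scalerAr.
- by rewrite counit_tgt rmorphM mulrA.
Qed.

Lemma counitr_balanced :
  balanced tgtl srcl (fun X1 X2 : L => tgt (counit L X2) * X1).
Proof.
split=> [y a u v|x a u v|i x y].
- by rewrite mulrDr scalerAr.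
- by rewrite linearP (linearP (tgt : {lrmorphism B^c -> L})) mulrDl scalerAl.
- by rewrite counit_src tgtM mulrA.
Qed.

Lemma comul_tgtr (b : B) (X : L) :
  comul (X * tgt b) = tmul_at 1 (tgt b) (comul X).
Proof.
have e1 : comul (tgt b : L) = pureB 1 (tgt b).
  by have := comul_tgt b 1; rewrite mulr1 comul1 tensB_ract_pure mulr1.
by rewrite comulM e1 /tmul (tlift_pure (tmul_balanced (comul_takeuchi X))).
Qed.

Lemma hopf_at_bal (Y : L) i x y :
  pureB (tgtl i x) (y * Y) = pureB x (srcl i y * Y).
Proof. by rewrite /tgtl /srcl -mulrA pureB_bal. Qed.

Lemma hopf_balanced : balanced tgtr tgtl
  (fun X Y : L => tmap id (fun Z => Z * Y) (comul X) : tensB L).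
Proof.
have lH Y := tmap_linear (@id_linear _ _) (mulr_linear Y) (@hopf_at_bal Y).
have pH Y := tmap_pure (@id_linear _ _) (mulr_linear Y) (@hopf_at_bal Y).
split=> [Y a u v|X a Y Y'|b X Y].
- by rewrite linearP lH.
- move: (comul X); apply: tens_ext => [||x y]; first exact: lH.
    move=> c u v; rewrite !lH !scalerDr !scalerA mulrC.
    by rewrite -!addrA; congr (_ + _); rewrite addrCA.
  by rewrite !pH mulrDr -scalerAr tpure_linearr.
rewrite /tgtr comul_tgtr; move: (comul X); apply: tens_ext => [||x y].
- exact: comp_linear (lH Y) (@tmul_at_linear _ _ L 1 (tgt b)).
- exact: lH.
- by rewrite tmul_at_pure !pH mulr1 /tgtl mulrA.
Qed.

Lemma bisection_mul_balanced (sigma eta : L -> B) :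
  left_bisection sigma -> left_bisection eta ->
  balanced tgtl srcl (fun X1 X2 : L => sigma (src (eta X1) * X2)).
Proof.
move=> sP eP; split=> [y a u v|x a u v|i x y].
- rewrite (bisection_linear eP) linearP mulrDl -scalerAl.
  exact: bisection_linear.
- by rewrite mulrDr -scalerAr; apply: bisection_linear.
- by rewrite /tgtl /srcl (bisection_tgt eP) rmorphM mulrA.
Qed.

Lemma bisection_inv_balanced (sigma : L -> B) : left_bisection sigma ->
  balanced tgtr tgtl (fun Xp Xm : L => counit L (Xp * tgt (sigma Xm))).
Proof.
move=> sP; split=> [y a u v|x a u v|i x y].
- by rewrite mulrDl -scalerAl linearP.
- rewrite (bisection_linear sP) (linearP (tgt : {lrmorphism B^c -> L})).
  by rewrite mulrDr -scalerAr linearP.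
- by rewrite /tgtr /tgtl (bisection_tgt sP) tgtM mulrA.
Qed.

Lemma bisection_src (sigma : L -> B) (b : B) (X : L) : left_bisection sigma ->
  sigma (src b * X) = sigma (src b) * sigma X.
Proof.
move=> sP; have [fL [_ fM] fB] := bisection_aut sP.
rewrite (bisectionM_src sP) -rmorphM [LHS]fM /=; congr (_ * _).
by have [_ /(_ (sigma X))] := bij_invK fB.
Qed.

Lemma vertical_mul_balanced (sigma tau : L -> B) :
  vertical_bisections L sigma -> left_bisection tau ->
  balanced tgtl srcl (fun X1 X2 : L => tau X1 * sigma X2).
Proof.
move=> [sP sV] tP; split=> [y a u v|x a u v|i x y].
- by rewrite (bisection_linear tP) mulrDl scalerAl.
- by rewrite (bisection_linear sP) mulrDr scalerAr.
- rewrite /tgtl /srcl (bisection_tgt tP) (bisection_src _ _ sP).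
  by rewrite [sigma (src i)](congr1 (fun f => f i) sV) mulrA.
Qed.

End BisectionFacts.

Section MonoidsOfFunctions.
Context {T : Type}.
Implicit Types (S : set T) (op : T -> T -> T) (e : T) (inv : T -> T).

Record monoid_on S op e : Prop := MonoidOn {
  monoid_closed : forall x y, S x -> S y -> S (op x y);
  monoid_unit : S e;
  monoid_assoc : forall x y z, S x -> S y -> S z ->
    op x (op y z) = op (op x y) z;
  monoid_mul1 : forall x, S x -> op e x = x;
  monoid_mulr1 : forall x, S x -> op x e = x
}.

Record group_on S op e inv : Prop := GroupOn {
  group_monoid : monoid_on S op e;
  group_inv_closed : forall x, S x -> S (inv x);
  group_mulV : forall x, S x -> op (inv x) x = e;
  group_mulrV : forall x, S x -> op x (inv x) = e
}.

Definition submonoid_of S' S op e : Prop :=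
  [/\ S' `<=` S, S' e & forall x y, S' x -> S' y -> S' (op x y)].

Definition subgroup_of S' S op e inv : Prop :=
  submonoid_of S' S op e /\ forall x, S' x -> S' (inv x).

End MonoidsOfFunctions.

(* Main.v *)
Require Import Defs.
From HB Require Import structures.
From mathcomp Require Import all_boot all_algebra.
From mathcomp Require Import boolp classical_sets functions.

(** Write phi for sigma o s.  A left bisection satisfies
    sigma (s(b) X) = phi b * sigma X and sigma (t(b) X) = sigma X * b, so

      (sigma * eta) X = phi (eta X1) * sigma X2.

    The second form of the product condition on bisections follows from the
    first one and the bijectivity of phi ([left_bisection_of_tgt]), so only
    sigma (X Y) = sigma (X t(sigma Y)) has to be carried through the
    constructions.

    Monoid.  For sigma * eta the product condition comes from multiplicativity
    of the coproduct and from the Takeuchi condition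
    X1 t(b) (x) X2 = X1 (x) X2 s(b), which transfers the value eta Y1 produced
    in the first factor to the second one, where sigma absorbs it
    ([bisection_mulM]).  Associativity is coassociativity read through the map
    x (x) y (x) z |-> phi (eta (s(tau x)) * eta y) * sigma z, and the unit laws
    are the counit laws.

    Inverse.  Put F (x (x) y) = counit (x t(sigma y)) on L (x)_{B^op} L
    ([counit_twist]), so that the proposed inverse is phi^-1 (F (X+ (x) X-)).
    The point is that F (X+ (x) X- Y) = F (X+ (x) X-) * sigma Y
    ([counit_twist_mulr]): sigma (X- Y) = sigma (X- t(sigma Y)), and
    X+ (x) X- t(b) = t(b) X+ (x) X-, where the t(b) leaves the counit on the
    right.  Hence (sigma * sigma^-1) X = F (X1+ (x) X1- X2) = F (X (x) 1)
    = counit X, because X1+ (x) X1- X2 is lambda^-1 (lambda (X (x) 1)).  That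
    sigma^-1 is again a bisection follows from the behaviour of X+ (x) X- under
    products and under multiplication by s(b) and t(b), each formula being
    checked after applying the injective map lambda.

    Only sigma * sigma^-1 = counit is computed.  In a monoid in which every
    element has a right inverse these are two-sided inverses
    ([monoid_group_on]), which spares the other identity and the comparison of
    X+1 (x) X+2 (x) X- with X1 (x) X2+ (x) X2- that it would need.

    The vertical bisections are those with phi = id; since phi is multiplicative
    in sigma ([bisection_mul_srcE], [bisection_inv_srcE]), they are stable under
    the operations. *)

Set Implicit Arguments.
Unset Strict Implicit.
Unset Printing Implicit Defensive.

Import GRing.Theory.
Local Open Scope ring_scope.

(** * Sums over tensors *)

Section TensorCalculus.
Context {k : fieldType}.

Lemma linear_map0 (U V : lmodType k) (h : U -> V) : linear h -> h 0 = 0.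
Proof. by move=> lh; have := lh (-1) 0 0; rewrite scaler0 addr0 scaleN1r addNr. Qed.

Lemma linear_map_sum (U V : lmodType k) (h : U -> V) (T : Type) (s : seq T)
    (F : T -> U) : linear h -> h (\sum_(p <- s) F p) = \sum_(p <- s) h (F p).
Proof.
move=> lh; elim: s => [|p s ih]; first by rewrite !big_nil linear_map0.
by rewrite !big_cons -[F p]scale1r lh ih !scale1r.
Qed.

Context {I : Type} {M N : lmodType k} {r : I -> M -> M} {l : I -> N -> N}.
Implicit Types (u : btens r l).

Lemma eq_tlift (V : lmodType k) (f g : M -> N -> V) u :
  (forall x y, f x y = g x y) -> tlift f u = tlift g u.
Proof. by move=> fg; apply: eq_bigr. Qed.

(** Maps out of a tensor product are sums over one representative, so a linear
    map passes inside even when f is not balanced. *)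
Lemma linear_tlift (U V : lmodType k) (h : U -> V) (f : M -> N -> U) u :
  linear h -> h (tlift f u) = tlift (fun x y => h (f x y)) u.
Proof. exact: linear_map_sum. Qed.

Lemma tlift_family_linear (U V : lmodType k) (f : U -> M -> N -> V) u :
  (forall x y, linear (fun c => f c x y)) -> linear (fun c => tlift (f c) u).
Proof.
move=> lf a c d; rewrite /tlift scaler_sumr -big_split /=.
by apply: eq_bigr => p _; rewrite lf.
Qed.

Context {I' : Type} {M' N' : lmodType k}.
Context {r' : I' -> M' -> M'} {l' : I' -> N' -> N'}.

(** Only f has to be balanced: g and h act on a fixed representative, and the
    resulting pure tensors are evaluated by f.  This makes it possible to
    substitute in a tensor without checking that the substitution itself is well
    defined on the quotient. *)
Lemma tlift_tmap (V : lmodType k) (f : M' -> N' -> V) (g : M -> M')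
    (h : N -> N') u : balanced r' l' f ->
  tlift f (tmap g h u : btens r' l') = tlift (fun x y => f (g x) (h y)) u.
Proof.
move=> fP; rewrite /tmap (linear_tlift _ _ (tlift_linear fP)).
by apply: eq_tlift => x y; rewrite tlift_pure.
Qed.

End TensorCalculus.

(** * Factorwise multiplication on the tensor square *)

Section BeRingFacts.
Context {k : fieldType} {B : algType k} {L : be_ring B}.
Implicit Types (b : B) (X Y : L) (w : tensB L).

Lemma tgt_linear : linear (tgt : B -> L).
Proof. exact: (linearP (tgt : {lrmorphism B^c -> L})). Qed.

Lemma tgt1 : tgt (1 : B) = 1 :> L.
Proof. exact: (rmorph1 (tgt : {lrmorphism B^c -> L})). Qed.

Lemma tmul_at_lact b X Y w :
  tmul_at X Y (tensB_lact b w) = tensB_lact b (tmul_at X Y w).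
Proof.
move: w; apply: tens_ext => [||x y].
- exact: comp_linear (@tmul_at_linear _ _ L X Y) (tensB_lact_linear b).
- exact: comp_linear (tensB_lact_linear b) (@tmul_at_linear _ _ L X Y).
- by rewrite tensB_lact_pure !tmul_at_pure tensB_lact_pure mulrA.
Qed.

Lemma tmul_at_ract b X Y w :
  tmul_at X Y (tensB_ract b w) = tensB_ract b (tmul_at X Y w).
Proof.
move: w; apply: tens_ext => [||x y].
- exact: comp_linear (@tmul_at_linear _ _ L X Y) (tensB_ract_linear b).
- exact: comp_linear (tensB_ract_linear b) (@tmul_at_linear _ _ L X Y).
- by rewrite tensB_ract_pure !tmul_at_pure tensB_ract_pure mulrA.
Qed.

Lemma tmul_atM (X Y X' Y' : L) w :
  tmul_at X' Y' (tmul_at X Y w) = tmul_at (X * X') (Y * Y') w.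
Proof.
move: w; apply: tens_ext => [||x y].
- exact: comp_linear (@tmul_at_linear _ _ L X' Y') (@tmul_at_linear _ _ L X Y).
- exact: tmul_at_linear.
- by rewrite !tmul_at_pure !mulrA.
Qed.

End BeRingFacts.

(** * The monoid of left bisections *)

Section BisectionMonoid.
Context {k : fieldType} {B : algType k} {L : left_bialgebroid B}.
Implicit Types (sigma eta tau : L -> B) (X Y : L) (b c : B).

(** The condition through s holds because sigma (X s(phi^-1 (sigma Y))) is, by
    the condition through t, sigma (X t(phi (phi^-1 (sigma Y)))). *)
Lemma left_bisection_of_tgt sigma : linear sigma -> sigma 1 = 1 ->
  (forall b X, sigma (tgt b * X) = sigma X * b) ->
  algebra_automorphism (sigma \o src) ->
  (forall X Y, sigma (X * Y) = sigma (X * tgt (sigma Y))) ->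
  left_bisection sigma.
Proof.
move=> sl s1 st sA sM; split=> // X Y; rewrite [RHS]sM.
have [_ /(_ (sigma Y)) /= ->] := bij_invK (algaut_bij sA).
exact: sM.
Qed.

Lemma bisection_src_linear sigma a b c : left_bisection sigma ->
  sigma (src (a *: b + c)) = a *: sigma (src b) + sigma (src c).
Proof. by move=> sP; rewrite linearP (bisection_linear sP). Qed.

Lemma bisection_srcM sigma b c : left_bisection sigma ->
  sigma (src (b * c)) = sigma (src b) * sigma (src c).
Proof. by move=> sP; rewrite rmorphM (bisection_src _ _ sP). Qed.

Lemma bisection_mulE sigma eta X : left_bisection sigma ->
  bisection_mul L sigma eta X
  = tlift (fun X1 X2 => sigma (src (eta X1)) * sigma X2) (comul X).
Proof. by move=> sP; apply: eq_tlift => x y; rewrite bisection_src. Qed.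

Lemma bisection_mul_linear sigma eta :
  left_bisection sigma -> left_bisection eta ->
  linear (bisection_mul L sigma eta).
Proof.
move=> sP eP a u v; rewrite /bisection_mul linearP.
exact: tlift_linear (bisection_mul_balanced sP eP) _ _ _.
Qed.

Lemma bisection_mul_one sigma eta :
  left_bisection sigma -> left_bisection eta -> bisection_mul L sigma eta 1 = 1.
Proof.
move=> sP eP; rewrite /bisection_mul comul1.
rewrite (tlift_pure (bisection_mul_balanced sP eP)).
by rewrite (bisection1 eP) rmorph1 mulr1 (bisection1 sP).
Qed.

Lemma bisection_mul_tgt sigma eta b X :
  left_bisection sigma -> left_bisection eta ->
  bisection_mul L sigma eta (tgt b * X) = bisection_mul L sigma eta X * b.
Proof.
move=> sP eP; rewrite /bisection_mul comul_tgt.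
rewrite (tlift_tmap _ _ _ (bisection_mul_balanced sP eP)).
rewrite (linear_tlift _ _ (mulr_linear b)).
apply: eq_tlift => x y.
by rewrite /tgtl mulrA src_tgtC -mulrA (bisection_tgt sP).
Qed.

Lemma bisection_mul_src sigma eta b X :
  left_bisection sigma -> left_bisection eta ->
  bisection_mul L sigma eta (src b * X)
  = sigma (src (eta (src b))) * bisection_mul L sigma eta X.
Proof.
move=> sP eP; rewrite /bisection_mul comul_src.
rewrite (tlift_tmap _ _ _ (bisection_mul_balanced sP eP)).
rewrite (linear_tlift _ _ (mull_linear _)).
apply: eq_tlift => x y.
rewrite /srcl (bisection_src _ _ eP) rmorphM -mulrA.
by rewrite !(bisection_src _ _ sP).
Qed.

(** Thus sigma |-> sigma o s is a monoid morphism to Aut B; the vertical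
    bisections are its kernel. *)
Lemma bisection_mul_srcE sigma eta :
  left_bisection sigma -> left_bisection eta ->
  bisection_mul L sigma eta \o src = (sigma \o src) \o (eta \o src).
Proof.
move=> sP eP; apply/funext => b /=; rewrite -[src b in LHS]mulr1.
by rewrite bisection_mul_src // bisection_mul_one // mulr1.
Qed.

Lemma algebra_automorphism_comp (f g : B -> B) :
  algebra_automorphism f -> algebra_automorphism g ->
  algebra_automorphism (f \o g).
Proof.
move=> [fl [f1 fM] fB] [gl [g1 gM] gB]; split.
- exact: comp_linear.
- by split=> [|x y] /=; rewrite ?g1 ?f1 // gM fM.
- exact: bij_comp.
Qed.

(** With f x y = phi (eta x) * sigma (y Y2), the value at X Y is a sum of
    f (X1 Y1) X2 = f (X1 t(eta Y1)) X2 = f X1 (X2 s(eta Y1)) by the Takeuchi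
    condition.  The last term is phi (eta X1) * sigma (X2 t(c)) with
    c = sigma (s(eta Y1) Y2), and the sum of these c over the coproduct of Y is
    (sigma * eta) Y. *)
Lemma bisection_mulM sigma eta X Y :
  left_bisection sigma -> left_bisection eta ->
  bisection_mul L sigma eta (X * Y)
  = bisection_mul L sigma eta (X * tgt (bisection_mul L sigma eta Y)).
Proof.
move=> sP eP; have fP := bisection_mul_balanced sP eP.
(* The summand of (sigma * eta) (X t(c)), kept linear in c so that the sum over
   the coproduct of Y can be pulled out of c. *)
pose act c x y := sigma (src (eta x)) * sigma (y * tgt c).
have actE c : bisection_mul L sigma eta (X * tgt c) = tlift (act c) (comul X).
  rewrite /bisection_mul comul_tgtr (tlift_tmap _ _ _ fP).
  by apply: eq_tlift => x y; rewrite mulr1 (bisection_src _ _ sP).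
have act_linear : linear (fun c => tlift (act c) (comul X)).
  apply: tlift_family_linear => x y a c d; rewrite /act tgt_linear mulrDr.
  by rewrite -scalerAr (bisection_linear sP) mulrDr -scalerAr.
rewrite actE /bisection_mul (linear_tlift _ _ act_linear) comulM /tmul.
rewrite (linear_tlift _ _ (tlift_linear fP)).
apply: eq_tlift => x' y'; rewrite /tmul_at (tlift_tmap _ _ _ fP).
pose f x y := sigma (src (eta x)) * sigma (y * y').
have f_bal : balanced tgtl srcl f.
  split=> [y a u v|x a u v|i x y]; rewrite /f.
  - rewrite (bisection_linear eP) linearP (bisection_linear sP).
    by rewrite mulrDl scalerAl.
  - by rewrite mulrDl -scalerAl (bisection_linear sP) mulrDr -scalerAr.
  - rewrite /tgtl /srcl (bisection_tgt eP) rmorphM (bisection_src _ _ sP) -!mulrA.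
    by rewrite (bisection_src _ _ sP).
transitivity (tlift f (tmap (tgtr (eta x')) id (comul X) : tensB L)).
  rewrite (tlift_tmap _ _ _ f_bal); apply: eq_tlift => x y.
  by rewrite (bisection_src _ _ sP) /f /tgtr -(bisectionM_tgt eP).
rewrite comul_takeuchi (tlift_tmap _ _ _ f_bal); apply: eq_tlift => x y.
by rewrite /f /srcr /act -mulrA -(bisectionM_tgt sP).
Qed.

Lemma bisection_mul_closed sigma eta :
  left_bisection sigma -> left_bisection eta ->
  left_bisection (bisection_mul L sigma eta).
Proof.
move=> sP eP; apply: left_bisection_of_tgt.
- exact: bisection_mul_linear.
- exact: bisection_mul_one.
- by move=> b X; apply: bisection_mul_tgt.
- rewrite bisection_mul_srcE //.
  by apply: algebra_automorphism_comp; apply: bisection_aut.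
- by move=> X Y; apply: bisection_mulM.
Qed.

Lemma counit_srcE b : counit L (src b) = b.
Proof. by rewrite -[src b]mulr1 counit_src counit1 mulr1. Qed.

Lemma algebra_automorphism_id : algebra_automorphism (@id B).
Proof. by split; [|split|exists id]. Qed.

Lemma counit_bisection : left_bisection (counit L).
Proof.
apply: left_bisection_of_tgt.
- exact: linearP.
- exact: counit1.
- exact: counit_tgt.
- have -> : counit L \o src = id by apply/funext => b /=; rewrite counit_srcE.
  exact: algebra_automorphism_id.
- by move=> X Y; rewrite counitM_tgt.
Qed.

(** Both products are the image of the iterated coproduct under
    x (x) y (x) z |-> phi (eta (s(tau x)) * eta y) * sigma z. *)
Lemma bisection_mulA sigma eta tau :
  left_bisection sigma -> left_bisection eta -> left_bisection tau ->
  bisection_mul L sigma (bisection_mul L eta tau)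
  = bisection_mul L (bisection_mul L sigma eta) tau.
Proof.
move=> sP eP tP; apply/funext => X.
have seP := bisection_mul_closed sP eP.
have phil a b c := bisection_src_linear a b c sP.
have phiM b c := bisection_srcM b c sP.
have etal a b c := bisection_src_linear a b c eP.
have etaM b c := bisection_srcM b c eP.
pose f x y z := sigma (src (eta (src (tau x)) * eta y : B)) * sigma z.
have f_bal x : balanced tgtl srcl (f x).
  split=> [z a u v|y a u v|i y z]; rewrite /f.
  - rewrite (bisection_linear eP) mulrDr -scalerAr.
    by rewrite phil mulrDl -scalerAl.
  - by rewrite (bisection_linear sP) mulrDr -scalerAr.
  - rewrite /tgtl /srcl (bisection_tgt eP) (bisection_src _ _ sP).
    by rewrite [in LHS]mulrA [in LHS]phiM -[in LHS]mulrA.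
pose g x (u : tensB L) := tlift (f x) u.
have g_bal : balanced tgtl tensB_lact g.
  split=> [u a x x'|x a u v|i x u]; rewrite /g.
  - have fl y z : linear (fun x => f x y z).
      move=> c v w; rewrite /f (bisection_linear tP) etal mulrDl -scalerAl phil.
      by rewrite mulrDl -scalerAl.
    exact: (tlift_family_linear u fl).
  - exact: tlift_linear (f_bal x) _ _ _.
  - rewrite /tensB_lact (tlift_tmap _ _ _ (f_bal x)).
    apply: eq_tlift => y z; rewrite /f /tgtl /srcl (bisection_tgt tP) etaM.
    by rewrite (bisection_src _ _ eP) mulrA.
have gl := tlift_linear g_bal.
transitivity (tlift g (tens_assoc (tmap comul id (comul X)) : tensBr L)).
  rewrite /tens_assoc (tlift_tmap _ _ _ (tens_assoc_balanced L)).
  rewrite (linear_tlift _ _ gl) bisection_mulE //; apply: eq_tlift => x z.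
  rewrite /tens_assoc_at (linear_tlift _ _ gl) bisection_mulE //.
  pose h := fun b : B => sigma (src b) * sigma z.
  have hl : linear h by move=> a u v; rewrite /h phil mulrDl -scalerAl.
  rewrite -[LHS]/(h _) (linear_tlift _ _ hl); apply: eq_tlift => a b.
  by rewrite (tlift_pure g_bal) /g (tlift_pure (f_bal _)).
rewrite comulA (tlift_tmap _ _ _ g_bal) bisection_mulE //.
apply: eq_tlift => x u.
have /(congr1 (fun f => f (tau x))) /= -> := bisection_mul_srcE sP eP.
rewrite bisection_mulE // (linear_tlift _ _ (mull_linear _)).
by apply: eq_tlift => y z; rewrite /f mulrA [in LHS]phiM.
Qed.

Lemma bisection_mul1 eta :
  left_bisection eta -> bisection_mul L (counit L) eta = eta.
Proof.
move=> eP; apply/funext => X; rewrite -[RHS](congr1 eta (counitr X)).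
rewrite (linear_tlift _ _ (bisection_linear eP)).
by apply: eq_tlift => x y; rewrite counit_src (bisection_tgt eP).
Qed.

Lemma bisection_mulr1 sigma :
  left_bisection sigma -> bisection_mul L sigma (counit L) = sigma.
Proof.
move=> sP; apply/funext => X; rewrite -[RHS](congr1 sigma (counitl X)).
by rewrite (linear_tlift _ _ (bisection_linear sP)).
Qed.

Lemma bisection_monoid :
  monoid_on (left_bisections L) (bisection_mul L) (counit L).
Proof.
split.
- exact: bisection_mul_closed.
- exact: counit_bisection.
- exact: bisection_mulA.
- exact: bisection_mul1.
- exact: bisection_mulr1.
Qed.

Lemma vertical_submonoid :
  submonoid_of (vertical_bisections L) (left_bisections L)
    (bisection_mul L) (counit L).
Proof.
split=> [sigma []//||sigma eta [sP sV] [eP eV]].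
  split; first exact: counit_bisection.
  by apply/funext => b /=; rewrite counit_srcE.
split; first exact: bisection_mul_closed.
by rewrite bisection_mul_srcE // sV eV.
Qed.

Lemma vertical_mulE sigma tau X : vertical_bisections L sigma ->
  bisection_mul L sigma tau X
  = tlift (fun X1 X2 => tau X1 * sigma X2) (comul X).
Proof.
move=> [sP sV]; rewrite bisection_mulE //; apply: eq_tlift => x y.
by have /(congr1 (fun f => f (tau x))) /= -> := sV.
Qed.

End BisectionMonoid.

(** * The translation map of a left Hopf algebroid *)

Section Translation.
Context {k : fieldType} {B : algType k} {L : left_bialgebroid B}.
Implicit Types (sigma : L -> B) (X Y : L) (b c : B) (u : tensBop L) (w : tensB L).

Lemma hopf_mapE u :
  hopf_map u = tlift (fun x y => tmul_at 1 y (comul x)) u.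
Proof.
apply: eq_tlift => x y; apply: eq_tlift => a b; by rewrite mulr1.
Qed.

Lemma hopf_map_linear : linear (@hopf_map _ _ L).
Proof. exact: tlift_linear hopf_balanced. Qed.

Lemma hopf_map_pure X Y : hopf_map (pureBop X Y) = tmul_at 1 Y (comul X).
Proof.
rewrite /hopf_map (tlift_pure hopf_balanced).
by apply: eq_tlift => a b; rewrite mulr1.
Qed.

Lemma hopf_map_tmap (g h : L -> L) u :
  hopf_map (tmap g h u : tensBop L)
  = tlift (fun x y => tmul_at 1 (h y) (comul (g x))) u.
Proof.
rewrite /hopf_map (tlift_tmap _ _ _ hopf_balanced); apply: eq_tlift => x y.
by apply: eq_tlift => a b; rewrite mulr1.
Qed.

Lemma hopf_map_srcl b u :
  hopf_map (tmap (srcl b) id u : tensBop L) = tensB_lact b (hopf_map u).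
Proof.
rewrite hopf_map_tmap hopf_mapE (linear_tlift _ _ (tensB_lact_linear b)).
by apply: eq_tlift => x y; rewrite comul_src tmul_at_lact.
Qed.

Lemma hopf_map_tgtl b u :
  hopf_map (tmap (tgtl b) id u : tensBop L) = tensB_ract b (hopf_map u).
Proof.
rewrite hopf_map_tmap hopf_mapE (linear_tlift _ _ (tensB_ract_linear b)).
by apply: eq_tlift => x y; rewrite comul_tgt tmul_at_ract.
Qed.

Lemma hopf_map_mulr Y u :
  hopf_map (tmap id (fun y => y * Y) u : tensBop L) = tmul_at 1 Y (hopf_map u).
Proof.
rewrite hopf_map_tmap hopf_mapE (linear_tlift _ _ (@tmul_at_linear _ _ L 1 Y)).
by apply: eq_tlift => x y; rewrite tmul_atM mulr1.
Qed.

(** The Takeuchi condition: lambda (x (x) s(b) y) = x1 (x) x2 s(b) y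
    = x1 t(b) (x) x2 y. *)
Lemma hopf_map_srclr b u :
  hopf_map (tmap id (srcl b) u : tensBop L) = tmul_at (tgt b) 1 (hopf_map u).
Proof.
rewrite hopf_map_tmap hopf_mapE.
rewrite (linear_tlift _ _ (@tmul_at_linear _ _ L (tgt b) 1)).
apply: eq_tlift => x y; have f_bal := tmap_balanced
  (mulr_linear 1) (mulr_linear y) (@tmul_at_bal _ _ L 1 y).
transitivity (tmul_at 1 y (tmap id (srcr b) (comul x))).
  rewrite [RHS](tlift_tmap _ _ _ f_bal); apply: eq_tlift => a c.
  by rewrite /srcr /srcl mulrA.
rewrite -comul_takeuchi [LHS](tlift_tmap _ _ _ f_bal) tmul_atM.
by apply: eq_tlift => a c; rewrite /tgtr !mulr1 mul1r.
Qed.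

(** Left multiplication by a coproduct commutes with right multiplication in
    the second factor; stated on all tensors because w will be a value of
    lambda. *)
Lemma tmul_comul_at X Y w : tmul_at 1 Y (tmul (comul X) w) =
  tmul (comul X) (tmul_at 1 Y w).
Proof.
have tP := tmul_balanced (comul_takeuchi X).
have tl := tlift_linear tP; move: w; apply: tens_ext => [||a b].
- exact: comp_linear (@tmul_at_linear _ _ L 1 Y) tl.
- exact: comp_linear tl (@tmul_at_linear _ _ L 1 Y).
- by rewrite tmul_at_pure /tmul !(tlift_pure tP) tmul_atM mulr1.
Qed.

Hypothesis hL : left_hopf L.

Lemma hopf_map_inj : injective (@hopf_map _ _ L).
Proof. exact: bij_inj hL. Qed.

Lemma hopf_map_transl X : hopf_map (hopf_transl X) = pureB X 1.
Proof. by have [_] := bij_invK hL; apply. Qed.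

(** A formula for X+ (x) X- is verified by applying lambda to the candidate. *)
Lemma hopf_transl_eq X u : hopf_map u = pureB X 1 -> hopf_transl X = u.
Proof. by move=> h; apply: hopf_map_inj; rewrite hopf_map_transl. Qed.

Lemma hopf_transl_linear : linear (@hopf_transl _ _ L).
Proof.
move=> a X Y; apply: hopf_transl_eq.
by rewrite hopf_map_linear !hopf_map_transl /pureB tpure_linearl.
Qed.

Lemma hopf_transl1 : hopf_transl (1 : L) = pureBop 1 1.
Proof.
by apply: hopf_transl_eq; rewrite hopf_map_pure comul1 tmul_at_pure !mulr1.
Qed.

Lemma hopf_transl_src b X :
  hopf_transl (src b * X) = tmap (srcl b) id (hopf_transl X).
Proof.
by apply: hopf_transl_eq; rewrite hopf_map_srcl hopf_map_transl tensB_lact_pure.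
Qed.

(** Here lambda turns the candidate into X (x) s(b) = t(b) X (x) 1. *)
Lemma hopf_transl_tgt b X :
  hopf_transl (tgt b * X) = tmap id (fun y => y * src b) (hopf_transl X).
Proof.
apply: hopf_transl_eq; rewrite hopf_map_mulr hopf_map_transl tmul_at_pure.
by rewrite pureB_bal !mulr1 mul1r.
Qed.

Lemma hopf_transl_tgtr b X :
  hopf_transl (X * tgt b) = tmap id (srcl b) (hopf_transl X).
Proof.
apply: hopf_transl_eq; rewrite hopf_map_srclr hopf_map_transl tmul_at_pure.
by rewrite mulr1.
Qed.

(** Both sides are sent by lambda to X (x) t(b). *)
Lemma hopf_transl_takeuchi b X :
  tmap (tgtl b) id (hopf_transl X)
  = tmap id (fun y => y * tgt b) (hopf_transl X) :> tensBop L.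
Proof.
apply: hopf_map_inj; rewrite hopf_map_tgtl hopf_map_mulr hopf_map_transl.
by rewrite tensB_ract_pure tmul_at_pure !mulr1 mul1r.
Qed.

(** (XY)+ (x) (XY)- = X+ Y+ (x) Y- X-.  Indeed lambda (x Y+ (x) Y- y) is the
    coproduct of x times lambda (Y+ (x) Y-) = Y (x) 1, times y on the right, that
    is x1 Y (x) x2 y; summing over X+ (x) X- gives X Y (x) 1. *)
Lemma hopf_transl_mul X Y :
  hopf_transl (X * Y)
  = tlift (fun x y => tlift (fun x' y' => pureBop (x * x') (y' * y))
      (hopf_transl Y)) (hopf_transl X).
Proof.
apply: hopf_transl_eq; rewrite (linear_tlift _ _ hopf_map_linear).
have -> : pureB (X * Y) 1 = tmul_at Y 1 (hopf_map (hopf_transl X)).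
  by rewrite hopf_map_transl tmul_at_pure mulr1.
rewrite hopf_mapE (linear_tlift _ _ (@tmul_at_linear _ _ L Y 1)).
apply: eq_tlift => x y; have tP := tmul_balanced (comul_takeuchi x).
have l := comp_linear (@tmul_at_linear _ _ L 1 y) (tlift_linear tP).
rewrite tmul_atM mul1r mulr1.
transitivity (tmul_at 1 y (tmul (comul x) (hopf_map (hopf_transl Y)))).
  rewrite [in RHS]hopf_mapE [RHS](linear_tlift _ _ l).
  rewrite (linear_tlift _ _ hopf_map_linear); apply: eq_tlift => u v.
  rewrite hopf_map_pure comulM.
  rewrite -[RHS]/(tmul_at 1 y (tmul (comul x) (tmul_at 1 v (comul u)))).
  by rewrite -tmul_comul_at tmul_atM mulr1.
by rewrite hopf_map_transl /tmul (tlift_pure tP) tmul_atM mulr1 mul1r.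
Qed.

(** X1+ (x) X1- X2 = X (x) 1: lambda sends the left side to the coproduct of X,
    which is lambda (X (x) 1).  It is composed with F because it is used under
    [tlift]. *)
Lemma hopf_transl_comul (V : lmodType k) (F : tensBop L -> V) X : linear F ->
  tlift (fun X1 X2 => F (tmap id (fun y => y * X2) (hopf_transl X1))) (comul X)
  = F (pureBop X 1).
Proof.
move=> lF.
rewrite -(linear_tlift _ _ lF); congr F; apply: hopf_map_inj.
rewrite (linear_tlift _ _ hopf_map_linear) hopf_map_pure.
rewrite [comul X in RHS]tensE (linear_map_sum _ _ (@tmul_at_linear _ _ L 1 1)).
apply: eq_bigr => -[x y] _ /=.
by rewrite hopf_map_mulr hopf_map_transl !tmul_at_pure !mulr1 mul1r.
Qed.

End Translation.

(** * The inverse of a left bisection *)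

Section BisectionInverse.
Context {k : fieldType} {B : algType k} {L : left_bialgebroid B}.
Implicit Types (X Y : L) (b c : B) (u : tensBop L) (w : tensB L).
Hypothesis hL : left_hopf L.
Variable sigma : L -> B.
Hypothesis sP : left_bisection sigma.

Let phi b := sigma (src b).
Let psi := bij_inv (sigma \o src).

Let phiK : cancel phi psi.
Proof. by have [] := bij_invK (algaut_bij (bisection_aut sP)). Qed.

Let psiK : cancel psi phi.
Proof. by have [] := bij_invK (algaut_bij (bisection_aut sP)). Qed.

Definition counit_twist u : B :=
  tlift (fun x y => counit L (x * tgt (sigma y))) u.

Lemma counit_twist_linear : linear counit_twist.
Proof. exact: tlift_linear (bisection_inv_balanced sP). Qed.

Lemma counit_twist_pure X Y :
  counit_twist (pureBop X Y) = counit L (X * tgt (sigma Y)).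
Proof. exact: tlift_pure (bisection_inv_balanced sP) _ _. Qed.

Lemma counit_twist_tmap (g h : L -> L) u : counit_twist (tmap g h u)
  = tlift (fun x y => counit L (g x * tgt (sigma (h y)))) u.
Proof. exact: tlift_tmap (bisection_inv_balanced sP). Qed.

(** sigma (X- Y) = sigma (X- t(sigma Y)), the factor t(sigma Y) moves from X- to
    the left of X+, and the counit is right B-linear for that multiplication. *)
Lemma counit_twist_mulr X Y :
  counit_twist (tmap id (fun y => y * Y) (hopf_transl X))
  = counit_twist (hopf_transl X) * sigma Y.
Proof.
transitivity (counit_twist
    (tmap id (fun y => y * tgt (sigma Y)) (hopf_transl X))).
  rewrite !counit_twist_tmap; apply: eq_tlift => x y.
  by rewrite -(bisectionM_tgt sP).
rewrite -hopf_transl_takeuchi // counit_twist_tmap.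
rewrite [RHS](linear_tlift _ _ (mulr_linear _)); apply: eq_tlift => x y.
by rewrite -counit_tgt mulrA.
Qed.

Lemma bisection_invK X :
  phi (bisection_inv L sigma X) = counit_twist (hopf_transl X).
Proof. exact: psiK. Qed.

(** By [bisection_invK] and [counit_twist_mulr] the value at X is the sum of
    F (X1+ (x) X1- X2), which collapses to F (X (x) 1) = counit X. *)
Lemma bisection_mul_inv : bisection_mul L sigma (bisection_inv L sigma) = counit L.
Proof.
apply/funext => X; rewrite bisection_mulE //.
transitivity (counit_twist (pureBop X 1)).
  rewrite -(hopf_transl_comul hL _ counit_twist_linear); apply: eq_tlift => x y.
  by rewrite -[sigma (src _)]/(phi _) bisection_invK counit_twist_mulr.
by rewrite counit_twist_pure (bisection1 sP) tgt1 mulr1.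
Qed.

(** phi is injective, so identities for the inverse are checked after applying
    phi, which removes the outer phi^-1 of its definition. *)
Lemma bisection_inv_eq X b :
  counit_twist (hopf_transl X) = phi b -> bisection_inv L sigma X = b.
Proof. by move=> h; rewrite -[b]phiK -h. Qed.

Lemma bisection_inv_linear : linear (bisection_inv L sigma).
Proof.
move=> a X Y; apply: bisection_inv_eq.
rewrite hopf_transl_linear // counit_twist_linear /phi bisection_src_linear //.
by rewrite -!bisection_invK.
Qed.

Lemma bisection_inv_one : bisection_inv L sigma 1 = 1.
Proof.
apply: bisection_inv_eq; rewrite hopf_transl1 // counit_twist_pure.
by rewrite (bisection1 sP) tgt1 mulr1 counit1 /phi rmorph1 (bisection1 sP).
Qed.

Lemma bisection_inv_tgt b X :
  bisection_inv L sigma (tgt b * X) = bisection_inv L sigma X * b.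
Proof.
apply: bisection_inv_eq; rewrite hopf_transl_tgt // counit_twist_mulr.
by rewrite /phi bisection_srcM // -bisection_invK.
Qed.

Lemma bisection_inv_src b X :
  bisection_inv L sigma (src b * X) = psi b * bisection_inv L sigma X.
Proof.
apply: bisection_inv_eq; rewrite hopf_transl_src // counit_twist_tmap.
rewrite /phi bisection_srcM // -!/(phi _) psiK bisection_invK.
rewrite [RHS](linear_tlift _ _ (mull_linear _)); apply: eq_tlift => x y.
by rewrite -counit_src mulrA.
Qed.

Lemma bisection_inv_srcE : bisection_inv L sigma \o src = psi.
Proof.
apply/funext => b /=; rewrite -[src b]mulr1 bisection_inv_src.
by rewrite bisection_inv_one mulr1.
Qed.

Lemma algebra_automorphism_inv : algebra_automorphism psi.
Proof.
have phi_inj := can_inj phiK; split.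
- move=> a b c; apply: phi_inj.
  by rewrite psiK /phi bisection_src_linear // -!/(phi _) !psiK.
- split=> [|b c]; apply: phi_inj; rewrite psiK.
    by rewrite /phi rmorph1 (bisection1 sP).
  by rewrite /phi bisection_srcM // -!/(phi _) !psiK.
- by exists phi.
Qed.

(** Put e = F (Y+ (x) Y-) = phi (sigma^-1 Y).  Then
    F (X+ Y+ (x) Y- X-) = counit (X+ t(counit (Y+ t(sigma (Y- X-)))))
    = counit (X+ t(e * sigma X-)) = counit (X+ t(sigma (s(sigma^-1 Y) X-))),
    and (X t(b))+ (x) (X t(b))- = X+ (x) s(b) X-. *)
Lemma bisection_invM X Y : bisection_inv L sigma (X * Y)
  = bisection_inv L sigma (X * tgt (bisection_inv L sigma Y)).
Proof.
apply: bisection_inv_eq; rewrite bisection_invK hopf_transl_tgtr //.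
rewrite counit_twist_tmap hopf_transl_mul //.
rewrite (linear_tlift _ _ counit_twist_linear); apply: eq_tlift => x y.
rewrite (linear_tlift _ _ counit_twist_linear).
rewrite (bisection_src _ _ sP) -/(phi _) bisection_invK -counit_twist_mulr.
have l : linear (fun b => counit L (x * tgt b)).
  by move=> a b c; rewrite tgt_linear mulrDr -scalerAr linearP.
rewrite counit_twist_tmap (linear_tlift _ _ l); apply: eq_tlift => u v.
by rewrite counit_twist_pure counitM_tgt mulrA.
Qed.

Lemma bisection_inv_closed : left_bisection (bisection_inv L sigma).
Proof.
apply: left_bisection_of_tgt.
- exact: bisection_inv_linear.
- exact: bisection_inv_one.
- exact: bisection_inv_tgt.
- by rewrite bisection_inv_srcE; apply: algebra_automorphism_inv.
- exact: bisection_invM.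
Qed.

End BisectionInverse.

(** * The group structure *)

(** If y is a right inverse of x and z one of y, then z = x y z = x, so
    y x = y z = e. *)
Lemma monoid_group_on (T : Type) (S : classical_sets.set T) op e inv :
  monoid_on S op e -> (forall x, S x -> S (inv x)) ->
  (forall x, S x -> op x (inv x) = e) -> group_on S op e inv.
Proof.
move=> mP Si xV; split=> // x Sx; have Sy := Si x Sx; have Sz := Si _ Sy.
rewrite -{2}(_ : inv (inv x) = x) ?xV //.
rewrite -[LHS](monoid_mul1 mP) // -(xV x) // -(monoid_assoc mP) // xV //.
by rewrite (monoid_mulr1 mP).
Qed.

Section BisectionGroup.
Context {k : fieldType} {B : algType k} {L : left_bialgebroid B}.

Lemma bisection_group : left_hopf L ->
  group_on (left_bisections L) (bisection_mul L) (counit L) (bisection_inv L).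
Proof.
move=> hL; apply: monoid_group_on; first exact: bisection_monoid.
- by move=> sigma sP; apply: bisection_inv_closed.
- by move=> sigma sP; apply: bisection_mul_inv.
Qed.

Lemma vertical_subgroup : left_hopf L ->
  subgroup_of (vertical_bisections L) (left_bisections L)
    (bisection_mul L) (counit L) (bisection_inv L).
Proof.
move=> hL; split; first exact: vertical_submonoid.
move=> sigma [sP sV]; split; first exact: bisection_inv_closed.
rewrite bisection_inv_srcE // sV; apply/funext => b.
by have [idK _] := bij_invK (algaut_bij (@algebra_automorphism_id _ B)); apply: idK.
Qed.

End BisectionGroup.

Unset Implicit Arguments.

Theorem theorem3p2 (k : fieldType) (B : algType k) (L : left_bialgebroid B) :
  [/\ monoid_on (left_bisections L) (bisection_mul L) (counit L),
      left_hopf L ->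
        group_on (left_bisections L) (bisection_mul L) (counit L) (bisection_inv L),
      submonoid_of (vertical_bisections L) (left_bisections L)
        (bisection_mul L) (counit L),
      left_hopf L ->
        subgroup_of (vertical_bisections L) (left_bisections L)
          (bisection_mul L) (counit L) (bisection_inv L)
    & forall sigma tau : L -> B,
        vertical_bisections L sigma -> vertical_bisections L tau ->
        forall X : L,
          bisection_mul L sigma tau X
          = tlift (fun X1 X2 => tau X1 * sigma X2) (comul X)].
Proof.
split.
- exact: bisection_monoid.
- exact: bisection_group.
- exact: vertical_submonoid.
- exact: vertical_subgroup.
- by move=> sigma tau sV _ X; apply: vertical_mulE.
Qed.
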